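(* Let $A=(A,\cdot,1,\Delta,\epsilon,S)$ be a Hopf algebra over a field $k$. Then the category $\mathfrak{Br}(A)$ of Hopf braces whose first Hopf algebra structure is that of $A$ and the category $\mathfrak{C}(A)$ of bijective $1$-cocycles with target $A$ are equivalent.
   Context: Sweedler notation $\Delta(a)=a_1\otimes a_2$ (summation understood) is used. Hopf braces. Let $(A,\Delta,\epsilon)$ be a coalgebra over $k$. A Hopf brace structure over $A$ consists of two Hopf algebra structures $(A,\cdot,1,\Delta,\epsilon,S)$ and $(A,\circ,1_\circ,\Delta,\epsilon,T)$ on the same coalgebra (write $ab=a\cdot b$) such that $a\circ(bc)=(a_1\circ b)S(a_2)(a_3\circ c)$ for all $a,b,c\in A$. The Hopf brace is denoted $(A,\cdot,\circ)$. (It follows that $1_\circ=1$.) A homomorphism of Hopf braces $f:(A,\cdot,\circ)\to(B,\cdot,\circ)$ is a linear map $f:A\to B$ which is a Hopf algebra homomorphism for both the first and the second Hopf algebra structures. For a fixed Hopf algebra $A=(A,\cdot,1,\Delta,\epsilon,S)$, $\mathfrak{Br}(A)$ is the full subcategory of the category of Hopf braces whose objects are the Hopf braces $(A,\cdot,\circ)$ whose first Hopf algebra structure is the given one. Bijective $1$-cocycles. Let $H$ and $A$ be Hopf algebras and let $A$ be a left $H$-module-algebra with action $\rightharpoonup$. A bijective $1$-cocycle is a coalgebra isomorphism $\pi:H\to A$ such that $\pi(hk)=\pi(h_1)(h_2\rightharpoonup\pi(k))$ for all $h,k\in H$. A homomorphism from a bijective $1$-cocycle $\pi:H\to A$ to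 a bijective $1$-cocycle $\eta:K\to B$ is a pair $(f,g)$ of Hopf algebra maps $f:H\to K$, $g:A\to B$ such that $\eta f=g\pi$ and $g(h\rightharpoonup a)=f(h)\rightharpoonup g(a)$ for all $a\in A$, $h\in H$. For a fixed Hopf algebra $A$, $\mathfrak{C}(A)$ is the full subcategory of the category of bijective $1$-cocycles whose objects are the bijective $1$-cocycles $\pi:H\to A$ with target the Hopf algebra $A$ ($H$ and the $H$-module-algebra structure on $A$ may vary). *)

(* Defs.v *)
From HB Require Import structures.
From mathcomp Require Import all_boot all_order all_algebra.
From mathcomp Require Import generic_quotient boolp.

Set Implicit Arguments.
Unset Strict Implicit.
Unset Printing Implicit Defensive.

Import GRing.Theory.
Local Open Scope ring_scope.
Local Open Scope quotient_scope.

(* Vector spaces over the field k are lmodType k, of arbitrary dimension. *)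

Definition is_bilinear (k : fieldType) (V W U : lmodType k) (f : V -> W -> U) :
  Prop := (forall w, linear (fun v => f v w)) /\ (forall v, linear (f v)).

(* V (x) W is the set of finite formal sums of pairs (v, w), two such sums being
   identified when every bilinear map takes the same value on them. The
   universal property is proved below (tens_spanP, bigtensE, bigtens_linear,
   tens_ext). *)
Section Tensor.
Variables (k : fieldType) (V W : lmodType k).

Definition eval_pairs (U : nmodType) (f : V -> W -> U) (s : seq (V * W)) : U :=
  \sum_(p <- s) f p.1 p.2.

Definition tens_eqv (s t : seq (V * W)) : Prop :=
  forall (U : lmodType k) (f : V -> W -> U),
    is_bilinear f -> eval_pairs f s = eval_pairs f t.

Definition tens_rel (s t : seq (V * W)) : bool := `[< tens_eqv s t >].

Lemma tens_rel_refl : reflexive tens_rel.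
Proof. by move=> s; apply/asboolP => U f _. Qed.

Lemma tens_rel_sym : symmetric tens_rel.
Proof.
by move=> s t; apply/asboolP/asboolP => h U f bf; rewrite (h U f bf).
Qed.

Lemma tens_rel_trans : transitive tens_rel.
Proof.
by move=> t s u /asboolP h1 /asboolP h2; apply/asboolP => U f bf; rewrite h1 ?h2.
Qed.

Canonical tens_equiv := EquivRel tens_rel tens_rel_refl tens_rel_sym tens_rel_trans.

Definition tens : Type := {eq_quot tens_equiv}.
HB.instance Definition _ := Choice.on tens.
HB.instance Definition _ := EqQuotient.on tens.

Lemma tens_pi_eqP s t : tens_eqv s t <-> \pi_tens s = \pi_tens t.
Proof.
split=> [h|/eqquotP h]; first by apply/eqquotP/asboolP.
exact/asboolP.
Qed.

Lemma repr_piE s : tens_eqv (repr (\pi_tens s)) s.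
Proof. by apply/tens_pi_eqP; rewrite reprK. Qed.

Definition tens_zero : tens := \pi_tens [::].
Definition tens_add (x y : tens) : tens := \pi_tens (repr x ++ repr y).
Definition scale_pairs (a : k) (s : seq (V * W)) :=
  [seq (a *: p.1, p.2) | p <- s].
Definition tens_scale (a : k) (x : tens) : tens := \pi_tens (scale_pairs a (repr x)).
Definition tens_opp (x : tens) : tens := tens_scale (-1) x.

Lemma eval_cat (U : lmodType k) (f : V -> W -> U) s t :
  eval_pairs f (s ++ t) = eval_pairs f s + eval_pairs f t.
Proof. exact: big_cat. Qed.

Lemma eval_scale (U : lmodType k) (f : V -> W -> U) a s :
  is_bilinear f -> eval_pairs f (scale_pairs a s) = a *: eval_pairs f s.
Proof.
case=> fl _; rewrite /eval_pairs big_map scaler_sumr; apply: eq_bigr => p _ /=.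
pose h := fun v => f v p.2.
have hl : linear h by exact: fl.
have h0 : h 0 = 0 by have := hl (-1) 0 0; rewrite scaler0 addr0 scaleN1r addNr.
by have := hl a p.1 0; rewrite !addr0 h0 addr0.
Qed.

Lemma tens_eqP (x y : tens) :
  (forall (U : lmodType k) (f : V -> W -> U), is_bilinear f ->
     eval_pairs f (repr x) = eval_pairs f (repr y)) -> x = y.
Proof. by move=> h; rewrite -[x]reprK -[y]reprK; apply/tens_pi_eqP. Qed.

Section Eval.
Variables (U : lmodType k) (f : V -> W -> U) (bf : is_bilinear f).
Lemma eval_zero : eval_pairs f (repr tens_zero) = 0.
Proof. by rewrite (repr_piE _ bf) /eval_pairs big_nil. Qed.
Lemma eval_add x y : eval_pairs f (repr (tens_add x y)) =
  eval_pairs f (repr x) + eval_pairs f (repr y).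
Proof. by rewrite (repr_piE _ bf) eval_cat. Qed.
Lemma eval_tscale a x :
  eval_pairs f (repr (tens_scale a x)) = a *: eval_pairs f (repr x).
Proof. by rewrite (repr_piE _ bf) eval_scale. Qed.
End Eval.

Lemma tens_addA : associative tens_add.
Proof. by move=> x y z; apply: tens_eqP => U f bf; rewrite !eval_add // addrA. Qed.
Lemma tens_addC : commutative tens_add.
Proof. by move=> x y; apply: tens_eqP => U f bf; rewrite !eval_add // addrC. Qed.
Lemma tens_add0 : left_id tens_zero tens_add.
Proof.
by move=> x; apply: tens_eqP => U f bf; rewrite eval_add // eval_zero // add0r.
Qed.
Lemma tens_addN : left_inverse tens_zero tens_opp tens_add.
Proof.
move=> x; apply: tens_eqP => U f bf.
by rewrite eval_add // eval_tscale // eval_zero // scaleN1r addNr.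
Qed.

HB.instance Definition _ :=
  GRing.isZmodule.Build tens tens_addA tens_addC tens_add0 tens_addN.

Lemma tens_scaleA a b x : tens_scale a (tens_scale b x) = tens_scale (a * b) x.
Proof. by apply: tens_eqP => U f bf; rewrite !eval_tscale // scalerA. Qed.
Lemma tens_scale1 : left_id 1 tens_scale.
Proof. by move=> x; apply: tens_eqP => U f bf; rewrite eval_tscale // scale1r. Qed.
Lemma tens_scaleDr : right_distributive tens_scale +%R.
Proof.
move=> a x y; apply: tens_eqP => U f bf.
by rewrite !(eval_tscale, eval_add) // scalerDr.
Qed.
Lemma tens_scaleDl x : {morph tens_scale^~ x : a b / a + b}.
Proof.
move=> a b; apply: tens_eqP => U f bf.
by rewrite !(eval_tscale, eval_add) // scalerDl.
Qed.

HB.instance Definition _ := GRing.Zmodule_isLmodule.Build k tens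
  tens_scaleA tens_scale1 tens_scaleDr tens_scaleDl.

Definition tensor (v : V) (w : W) : tens := \pi_tens [:: (v, w)].

(* The sum of f v_i w_i over a chosen decomposition t = sum_i v_i (x) w_i. When f
   is bilinear it does not depend on the decomposition, and bigtens f is the
   linear map on V (x) W induced by f. It is used below only with f bilinear. *)
Definition bigtens (U : nmodType) (f : V -> W -> U) (t : tens) : U :=
  eval_pairs f (repr t).

Lemma bigtens_linear (U : lmodType k) (f : V -> W -> U) :
  is_bilinear f -> linear (bigtens f).
Proof.
by move=> bf a x y; rewrite /bigtens eval_add // eval_tscale.
Qed.

Lemma bigtensE (U : lmodType k) (f : V -> W -> U) v w :
  is_bilinear f -> bigtens f (tensor v w) = f v w.
Proof. by move=> bf; rewrite /bigtens (repr_piE _ bf) /eval_pairs big_seq1. Qed.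

Lemma tensor_bilinear : is_bilinear tensor.
Proof.
split=> [w|v] a x y; apply: tens_eqP => U f bf;
  rewrite eval_add // eval_tscale // !(repr_piE _ bf) /eval_pairs !big_seq1 /=.
  exact: bf.1.
exact: bf.2.
Qed.

Lemma tens_spanP (t : tens) : t = \sum_(p <- repr t) tensor p.1 p.2.
Proof.
apply: tens_eqP => U f bf.
elim: (repr t) => [|p s IH].
  by rewrite big_nil eval_zero // /eval_pairs big_nil.
by rewrite big_cons eval_add // -IH (repr_piE _ bf) /eval_pairs big_seq1 big_cons.
Qed.

Lemma tens_ext (U : lmodType k) (g h : tens -> U) : linear g -> linear h ->
  (forall v w, g (tensor v w) = h (tensor v w)) -> g =1 h.
Proof.
move=> gl hl e t; rewrite (tens_spanP t).
have l0 (l : tens -> U) : linear l -> l 0 = 0.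
  by move=> ll; have := ll (-1) 0 0; rewrite scaler0 addr0 scaleN1r addNr.
elim: (repr t) => [|p s IH]; first by rewrite !big_nil !l0.
rewrite big_cons -[tensor _ _]scale1r gl hl IH.
by congr (_ *: _ + _); exact: e.
Qed.

End Tensor.

Arguments tens {k} V W.

Declare Scope hopf_scope.
Delimit Scope hopf_scope with hopf.
Local Open Scope hopf_scope.

Notation "V ⊗ W" := (tens V W) (at level 40, left associativity) : type_scope.
Notation "v ⊗ w" := (tensor v w) (at level 40, left associativity) : hopf_scope.

Record coalgebra (k : fieldType) := Coalgebra {
  coalg_sort :> lmodType k;
  comul : coalg_sort -> (coalg_sort ⊗ coalg_sort)%type;
  counit : coalg_sort -> k;
  comul_linear : linear comul;
  counit_linear : scalar counit;
  comulA : forall a : coalg_sort,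
    bigtens (fun x y => bigtens (fun y1 y2 => x ⊗ (y1 ⊗ y2)) (comul y)) (comul a)
    = bigtens (fun x y => bigtens (fun x1 x2 => x1 ⊗ (x2 ⊗ y)) (comul x)) (comul a);
  comul_counitl : forall a : coalg_sort,
    bigtens (fun x y => counit x *: y) (comul a) = a;
  comul_counitr : forall a : coalg_sort,
    bigtens (fun x y => counit y *: x) (comul a) = a }.

Arguments comul {k c} _.
Arguments counit {k c} _.

(* Sweedler notation; iterated as (id (x) comul) o comul for a_1, a_2, a_3. *)
Notation "'\sw_' ( x , y <- a ) F" := (bigtens (fun x y => F) (comul a))
  (at level 41, F at level 41, a at level 200, x name, y name,
   format "'\sw_' ( x ,  y  <-  a )  F") : ring_scope.
Notation "'\sw_' ( x , y , z <- a ) F" :=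
  (bigtens (fun x t => bigtens (fun y z => F) (comul t)) (comul a))
  (at level 41, F at level 41, a at level 200, x name, y name, z name,
   format "'\sw_' ( x ,  y ,  z  <-  a )  F") : ring_scope.

Record coalg_hom (k : fieldType) (C D : coalgebra k) (f : C -> D) : Prop :=
  CoalgHom {
    coalg_hom_linear : linear f;
    coalg_hom_comul : forall a : C, comul (f a) = \sw_(x, y <- a) (f x ⊗ f y);
    coalg_hom_counit : forall a : C, counit (f a) = counit a }.

Definition coalg_iso (k : fieldType) (C D : coalgebra k) (f : C -> D) : Prop :=
  coalg_hom f /\
  exists g : D -> C, [/\ coalg_hom g, cancel f g & cancel g f].

(* The structure is kept separate from the underlying coalgebra, since a Hopf
   brace carries two of them on the same coalgebra. *)
Record hopf_structure (k : fieldType) (C : coalgebra k) := HopfStructure {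
  hmul : C -> C -> C;
  hone : C;
  antipode : C -> C;
  hmul_bilinear : is_bilinear hmul;
  hmulA : associative hmul;
  hmul1l : left_id hone hmul;
  hmul1r : right_id hone hmul;
  comul_mul : forall a b : C, comul (hmul a b) =
    \sw_(a1, a2 <- a) \sw_(b1, b2 <- b) (hmul a1 b1 ⊗ hmul a2 b2);
  comul_one : comul hone = hone ⊗ hone;
  counit_mul : forall a b : C, counit (hmul a b) = counit a * counit b;
  counit_one : counit hone = 1;
  antipode_linear : linear antipode;
  antipodel : forall a : C,
    \sw_(a1, a2 <- a) hmul (antipode a1) a2 = counit a *: hone;
  antipoder : forall a : C,
    \sw_(a1, a2 <- a) hmul a1 (antipode a2) = counit a *: hone }.

(* Compatibility with the antipodes is automatic for bialgebra maps. *)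
Record hopf_hom_of (k : fieldType) (C D : coalgebra k)
    (H : hopf_structure C) (K : hopf_structure D) (f : C -> D) : Prop := HopfHom {
  hopf_hom_coalg : coalg_hom f;
  hopf_hom_mul : forall a b, f (hmul H a b) = hmul K (f a) (f b);
  hopf_hom_one : f (hone H) = hone K;
  hopf_hom_antipode : forall a, f (antipode H a) = antipode K (f a) }.

Record hopf_algebra (k : fieldType) := HopfAlgebra {
  hopf_coalg :> coalgebra k;
  hopf_str : hopf_structure hopf_coalg }.

Definition mulH (k : fieldType) (A : hopf_algebra k) : A -> A -> A :=
  hmul (hopf_str A).
Definition oneH (k : fieldType) (A : hopf_algebra k) : A := hone (hopf_str A).
Definition antiH (k : fieldType) (A : hopf_algebra k) : A -> A :=
  antipode (hopf_str A).

Notation "x · y" := (mulH x y) (at level 40, left associativity) : hopf_scope.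

Definition hopf_hom (k : fieldType) (A B : hopf_algebra k) (f : A -> B) : Prop :=
  hopf_hom_of (hopf_str A) (hopf_str B) f.

(* The units are not required to agree: this follows from brace_compat. *)
Record hopf_brace (k : fieldType) := HopfBrace {
  brace_hopf :> hopf_algebra k;
  brace_circ : hopf_structure brace_hopf;
  brace_compat : forall a b c : brace_hopf,
    hmul brace_circ a (b · c) =
    \sw_(a1, a2, a3 <- a)
      (hmul brace_circ a1 b · antiH a2 · hmul brace_circ a3 c) }.

Definition brace_hom (k : fieldType) (A B : hopf_brace k) (f : A -> B) : Prop :=
  hopf_hom f /\ hopf_hom_of (brace_circ A) (brace_circ B) f.

Record module_algebra (k : fieldType) (H A : hopf_algebra k) (act : H -> A -> A) :
    Prop := ModuleAlgebra {
  act_bilinear : is_bilinear act;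
  act_mul : forall (h l : H) (a : A), act (h · l) a = act h (act l a);
  act_one : forall a : A, act (oneH H) a = a;
  act_prod : forall (h : H) (a b : A),
    act h (a · b) = \sw_(h1, h2 <- h) (act h1 a · act h2 b);
  act_unit : forall h : H, act h (oneH A) = counit h *: oneH A }.

Record bij_cocycle (k : fieldType) := BijCocycle {
  coc_source : hopf_algebra k;
  coc_target : hopf_algebra k;
  coc_act : coc_source -> coc_target -> coc_target;
  coc_module : module_algebra coc_act;
  coc_map : coc_source -> coc_target;
  coc_iso : coalg_iso coc_map;
  coc_cocycle : forall h l : coc_source,
    coc_map (h · l) = \sw_(h1, h2 <- h) (coc_map h1 · coc_act h2 (coc_map l)) }.

Record cocycle_hom (k : fieldType) (p q : bij_cocycle k)
    (fg : (coc_source p -> coc_source q) * (coc_target p -> coc_target q)) : Prop :=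
  CocycleHom {
    cocycle_hom_source : hopf_hom fg.1;
    cocycle_hom_target : hopf_hom fg.2;
    cocycle_hom_map : forall h, coc_map (fg.1 h) = fg.2 (coc_map h);
    cocycle_hom_act : forall h a, fg.2 (coc_act h a) = coc_act (fg.1 h) (fg.2 a) }.

Record category := Category {
  obj :> Type;
  hom : obj -> obj -> Type;
  idm : forall X, hom X X;
  comp : forall X Y Z, hom Y Z -> hom X Y -> hom X Z;
  comp_idl : forall X Y (f : hom X Y), comp (idm Y) f = f;
  comp_idr : forall X Y (f : hom X Y), comp f (idm X) = f;
  compA : forall X Y Z T (f : hom Z T) (g : hom Y Z) (h : hom X Y),
    comp f (comp g h) = comp (comp f g) h }.

Arguments hom {c} _ _.
Arguments idm {c} _.
Arguments comp {c X Y Z} _ _.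

Record functor (C D : category) := Functor {
  fobj :> C -> D;
  fmap : forall X Y : C, hom X Y -> hom (fobj X) (fobj Y);
  fmap_id : forall X : C, fmap (idm X) = idm (fobj X);
  fmap_comp : forall (X Y Z : C) (f : hom Y Z) (g : hom X Y),
    fmap (comp f g) = comp (fmap f) (fmap g) }.

Arguments fmap {C D} _ {X Y} _.

Definition id_functor (C : category) : functor C C :=
  @Functor C C (fun X => X) (fun X Y f => f) (fun X => erefl)
    (fun X Y Z f g => erefl).

Definition comp_functor (C D E : category)
    (G : functor D E) (F : functor C D) : functor C E :=
  @Functor C E (fun X => G (F X)) (fun X Y f => fmap G (fmap F f))
    (fun X => etrans (congr1 (fmap G) (fmap_id F X)) (fmap_id G (F X)))
    (fun X Y Z f g =>
       etrans (congr1 (fmap G) (fmap_comp F f g)) (fmap_comp G _ _)).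

Record nat_iso (C D : category) (F G : functor C D) := NatIso {
  nat_fwd : forall X : C, hom (F X) (G X);
  nat_bwd : forall X : C, hom (G X) (F X);
  nat_fwdK : forall X, comp (nat_bwd X) (nat_fwd X) = idm (F X);
  nat_bwdK : forall X, comp (nat_fwd X) (nat_bwd X) = idm (G X);
  nat_natural : forall (X Y : C) (f : hom X Y),
    comp (nat_fwd Y) (fmap F f) = comp (fmap G f) (nat_fwd X) }.

Definition equivalent_categories (C D : category) : Prop :=
  exists (F : functor C D) (G : functor D C),
    inhabited (nat_iso (comp_functor G F) (id_functor C)) /\
    inhabited (nat_iso (comp_functor F G) (id_functor D)).

Definition full_subcategory (C : category) (P : C -> Prop) : category :=
  @Category {X : C | P X} (fun X Y => hom (sval X) (sval Y))
    (fun X => idm (sval X)) (fun X Y Z f g => comp f g)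
    (fun X Y f => comp_idl f) (fun X Y f => comp_idr f)
    (fun X Y Z T f g h => compA f g h).

Lemma coalg_hom_id (k : fieldType) (C : coalgebra k) : @coalg_hom k C C id.
Proof. by split=> // a; rewrite [LHS]tens_spanP. Qed.

Lemma coalg_hom_comp (k : fieldType) (C D E : coalgebra k)
    (f : D -> E) (g : C -> D) : coalg_hom f -> coalg_hom g -> coalg_hom (f \o g).
Proof.
move=> [fl fc fe] [gl gc ge].
have bf (X Y : coalgebra k) (h : X -> Y) : linear h ->
    is_bilinear (fun x y => h x ⊗ h y).
  by move=> hl; split=> [w|v] a x y; rewrite hl ?(tensor_bilinear _ _).1
                                             ?(tensor_bilinear _ _).2.
have fgl : linear (f \o g) by move=> a x y /=; rewrite gl fl.
split=> // [a|a] /=; last by rewrite fe ge.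
rewrite fc gc.
apply: (@tens_ext _ _ _ _ (fun t => bigtens (fun x y => f x ⊗ f y)
         (bigtens (fun x y => g x ⊗ g y) t)) (bigtens (fun x y => f (g x) ⊗ f (g y)))).
- by move=> c x y; rewrite (bigtens_linear (bf _ _ _ gl)) (bigtens_linear (bf _ _ _ fl)).
- exact: bigtens_linear (bf _ _ _ fgl).
- by move=> v w; rewrite !bigtensE //; [exact: bf _ _ _ fgl|exact: bf|exact: bf].
Qed.

Lemma hopf_hom_of_id (k : fieldType) (C : coalgebra k) (H : hopf_structure C) :
  hopf_hom_of H H id.
Proof. by split=> //; exact: coalg_hom_id. Qed.

Lemma hopf_hom_of_comp (k : fieldType) (C D E : coalgebra k)
    (H : hopf_structure C) (K : hopf_structure D) (L : hopf_structure E)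
    (f : D -> E) (g : C -> D) :
  hopf_hom_of K L f -> hopf_hom_of H K g -> hopf_hom_of H L (f \o g).
Proof.
move=> [fc fm f1 fS] [gc gm g1 gS]; split=> [|a b||a] /=.
- exact: coalg_hom_comp.
- by rewrite gm fm.
- by rewrite g1 f1.
- by rewrite gS fS.
Qed.

Lemma brace_hom_id (k : fieldType) (A : hopf_brace k) : @brace_hom k A A id.
Proof. by split; exact: hopf_hom_of_id. Qed.

Lemma brace_hom_comp (k : fieldType) (A B C : hopf_brace k)
    (f : B -> C) (g : A -> B) : brace_hom f -> brace_hom g -> brace_hom (f \o g).
Proof. by move=> [f1 f2] [g1 g2]; split; apply: hopf_hom_of_comp; eassumption. Qed.

Lemma cocycle_hom_id (k : fieldType) (p : bij_cocycle k) :
  @cocycle_hom k p p (id, id).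
Proof. by split=> //; exact: hopf_hom_of_id. Qed.

Lemma cocycle_hom_comp (k : fieldType) (p q r : bij_cocycle k)
    (f : (coc_source q -> coc_source r) * (coc_target q -> coc_target r))
    (g : (coc_source p -> coc_source q) * (coc_target p -> coc_target q)) :
  cocycle_hom f -> cocycle_hom g -> cocycle_hom (f.1 \o g.1, f.2 \o g.2).
Proof.
move=> [f1 f2 fm fa] [g1 g2 gm ga]; split=> [||h|h a] /=.
- exact: hopf_hom_of_comp f1 g1.
- exact: hopf_hom_of_comp f2 g2.
- by rewrite fm gm.
- by rewrite ga fa.
Qed.

Lemma sig_hom_eq (T : Type) (P : T -> Prop) (f g : {x | P x}) :
  sval f = sval g -> f = g.
Proof. by case: f g => [x p] [y q] /= e; exact: eq_exist. Qed.

Lemma pair_hom_idl (X Y X' Y' : Type) (fg : (X -> Y) * (X' -> Y')) :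
  (id \o fg.1, id \o fg.2) = fg.
Proof. by case: fg. Qed.

Lemma pair_hom_idr (X Y X' Y' : Type) (fg : (X -> Y) * (X' -> Y')) :
  (fg.1 \o id, fg.2 \o id) = fg.
Proof. by case: fg. Qed.

Definition brace_mor (k : fieldType) (A B : hopf_brace k) : Type :=
  {f : A -> B | brace_hom f}.

Definition brace_idm (k : fieldType) (A : hopf_brace k) : brace_mor A A :=
  exist _ id (brace_hom_id A).

Definition brace_comp (k : fieldType) (A B C : hopf_brace k)
    (f : brace_mor B C) (g : brace_mor A B) : brace_mor A C :=
  exist _ (sval f \o sval g) (brace_hom_comp (svalP f) (svalP g)).

Definition hopf_brace_cat (k : fieldType) : category :=
  @Category (hopf_brace k) (@brace_mor k) (@brace_idm k) (@brace_comp k)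
    (fun A B f => sig_hom_eq (f := brace_comp (brace_idm B) f) (g := f) erefl)
    (fun A B f => sig_hom_eq (f := brace_comp f (brace_idm A)) (g := f) erefl)
    (fun A B C D f g h =>
       sig_hom_eq (f := brace_comp f (brace_comp g h))
                  (g := brace_comp (brace_comp f g) h) erefl).

Definition cocycle_mor (k : fieldType) (p q : bij_cocycle k) : Type :=
  {fg : (coc_source p -> coc_source q) * (coc_target p -> coc_target q)
    | cocycle_hom fg}.

Definition cocycle_idm (k : fieldType) (p : bij_cocycle k) : cocycle_mor p p :=
  exist _ (id, id) (cocycle_hom_id p).

Definition cocycle_comp (k : fieldType) (p q r : bij_cocycle k)
    (f : cocycle_mor q r) (g : cocycle_mor p q) : cocycle_mor p r :=
  exist _ ((sval f).1 \o (sval g).1, (sval f).2 \o (sval g).2)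
    (cocycle_hom_comp (svalP f) (svalP g)).

Definition bij_cocycle_cat (k : fieldType) : category :=
  @Category (bij_cocycle k) (@cocycle_mor k) (@cocycle_idm k) (@cocycle_comp k)
    (fun p q f =>
       sig_hom_eq (f := cocycle_comp (cocycle_idm q) f) (g := f)
         (pair_hom_idl (sval f)))
    (fun p q f =>
       sig_hom_eq (f := cocycle_comp f (cocycle_idm p)) (g := f)
         (pair_hom_idr (sval f)))
    (fun p q r s f g h =>
       sig_hom_eq (f := cocycle_comp f (cocycle_comp g h))
                  (g := cocycle_comp (cocycle_comp f g) h) erefl).

Definition Br (k : fieldType) (A : hopf_algebra k) : category :=
  full_subcategory (fun B : hopf_brace_cat k => brace_hopf B = A).

Definition Coc (k : fieldType) (A : hopf_algebra k) : category :=
  full_subcategory (fun p : bij_cocycle_cat k => coc_target p = A).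

(* Main.v *)
Require Import Defs.
From mathcomp Require Import all_boot all_order all_algebra.
From mathcomp Require Import boolp.

Set Implicit Arguments.
Unset Strict Implicit.
Unset Printing Implicit Defensive.

Import GRing.Theory.
Local Open Scope ring_scope.
Local Open Scope hopf_scope.

(** Both functors leave the target Hopf algebra alone and move only the second
    multiplication.

    A Hopf brace carries the action a ⇀ b = S(a_1)(a_2 ∘ b) of (A, ∘) on the
    algebra (A, ·), and cancelling the antipode gives a ∘ b = a_1 (a_2 ⇀ b).
    This says exactly that the identity is a bijective 1-cocycle from (A, ∘) to
    (A, ·). That ⇀ is an action (brace_action_comp) is the one point that takes
    work: expanding (a ∘ b) ∘ c = a ∘ (b ∘ c) by means of ⇀ gives
    (a_1 ∘ b_1)((a_2 ∘ b_2) ⇀ c) = (a_1 ∘ b_1)(a_2 ⇀ (b_2 ⇀ c)), and the factor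
    a_1 ∘ b_1 cancels because ∘ is a coalgebra map, so that S(a ∘ b) is its
    convolution inverse.

    Conversely a bijective 1-cocycle π : H → A carries the multiplication of H
    to a second one on A, a ∘ b = π(π⁻¹(a) π⁻¹(b)) = a_1 (π⁻¹(a_2) ⇀ b). The
    brace identity then follows from the action being by module-algebra maps,
    once π⁻¹(a) ⇀ b is recognised as S(a_1)(a_2 ∘ b) (coc_action_circ).

    Starting from a brace and returning changes nothing up to the identity map.
    Starting from π and returning replaces π : H → A by the identity of A, and
    the pair (π, id) is an isomorphism between the two; it is natural because a
    morphism of cocycles (f, g) satisfies g π = η f. *)

(** * Linear and multilinear maps *)

Section Linearity.
Variable k : fieldType.
Implicit Types V W U X : lmodType k.

Lemma linear_idfun V : linear (fun v : V => v).
Proof. by []. Qed.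

Lemma linear_after V W U (g : W -> U) (f : V -> W) :
  linear g -> linear f -> linear (fun v => g (f v)).
Proof. by move=> gl fl a u v; rewrite fl gl. Qed.

Lemma linear_scale V W (s : V -> k) (w : W) :
  scalar s -> linear (fun v => s v *: w).
Proof. by move=> sl a u v; rewrite sl scalerDl scalerA. Qed.

Lemma linear_scalel V W (c : k) (f : V -> W) :
  linear f -> linear (fun v => c *: f v).
Proof. by move=> fl a u v; rewrite fl scalerDr !scalerA mulrC. Qed.

Lemma bilinear_l V W U X (F : V -> W -> U) (f : X -> V) (w : W) :
  is_bilinear F -> linear f -> linear (fun x => F (f x) w).
Proof. by move=> [Fl _] fl a u v; rewrite fl Fl. Qed.

Lemma bilinear_r V W U X (F : V -> W -> U) (v : V) (f : X -> W) :
  is_bilinear F -> linear f -> linear (fun x => F v (f x)).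
Proof. by move=> [_ Fr] fl a x y; rewrite fl Fr. Qed.

Lemma is_bilinearP V W U (F : V -> W -> U) :
  (forall w, linear (fun v => F v w)) -> (forall v, linear (fun w => F v w)) ->
  is_bilinear F.
Proof. by []. Qed.

Lemma linear_eq0 V W (f : V -> W) : linear f -> f 0 = 0.
Proof. by move=> fl; have := fl (-1) 0 0; rewrite scaler0 addr0 scaleN1r addNr. Qed.

Lemma linear_eqZ V W (f : V -> W) c v : linear f -> f (c *: v) = c *: f v.
Proof. by move=> fl; rewrite -[c *: v]addr0 fl (linear_eq0 fl) addr0. Qed.

(** A Sweedler sum is a finite sum over a chosen decomposition, so a linear map
    passes through it whether or not the summand is bilinear. *)
Lemma linear_bigtens V W U X (g : U -> X) (F : V -> W -> U) t :
  linear g -> g (bigtens F t) = bigtens (fun v w => g (F v w)) t.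
Proof.
move=> gl; rewrite /bigtens /eval_pairs.
elim: (generic_quotient.repr t) => [|p s IH]; first by rewrite !big_nil linear_eq0.
by rewrite !big_cons -[F _ _]scale1r gl IH !scale1r.
Qed.

Lemma bigtens_linear_param V W U X (F : X -> V -> W -> U) t :
  (forall v w, linear (fun x => F x v w)) -> linear (fun x => bigtens (F x) t).
Proof.
move=> Fl a u v; rewrite /bigtens /eval_pairs scaler_sumr -big_split /=.
by apply: eq_bigr => p _; rewrite Fl.
Qed.

Lemma bigtens_linear_arg V W U X (F : V -> W -> U) (f : X -> V ⊗ W) :
  is_bilinear F -> linear f -> linear (fun x => bigtens F (f x)).
Proof. by move=> Fb fl; apply: (linear_after (bigtens_linear Fb) fl). Qed.

Lemma eq_bigtens V W (U : nmodType) (F G : V -> W -> U) t :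
  (forall v w, F v w = G v w) -> bigtens F t = bigtens G t.
Proof. by move=> e; apply: eq_bigr => p _; apply: e. Qed.

Lemma bigtens_exchange V W V' W' (U : nmodType) (F : V -> W -> V' -> W' -> U) t s :
  bigtens (fun v w => bigtens (F v w) s) t =
  bigtens (fun v' w' => bigtens (fun v w => F v w v' w') t) s.
Proof. exact: exchange_big. Qed.

End Linearity.

(** Proves that an expression is linear, or bilinear, in the bound variables by
    descending through products, antipodes, tensors, Sweedler sums and the
    linear or bilinear maps found in the context. The rule for a variable that
    parametrises a Sweedler sum and the rule for one that is its argument apply
    in disjoint situations, because in a multilinear expression each variable
    occurs once. *)
Ltac multilinear :=
  cbv beta;
  match goal with
  | |- forall _, _ => intro; multilinear
  | |- is_bilinear _ => first [assumption | exact: hmul_bilinear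
      | exact: tensor_bilinear | apply: act_bilinear; eassumption
      | apply: is_bilinearP; multilinear]
  | |- GRing.linear_for _ _ => first [assumption
      | exact: linear_idfun | exact: comul_linear | exact: counit_linear
      | exact: antipode_linear | match goal with h : _ |- _ => exact: h end
      | apply: bigtens_linear_param; multilinear
      | apply: bigtens_linear_arg; multilinear
      | apply: linear_scale; multilinear
      | apply: linear_scalel; multilinear
      | apply: (bilinear_l _ (@hmul_bilinear _ _ _)); multilinear
      | apply: (bilinear_r _ (@hmul_bilinear _ _ _)); multilinear
      | apply: (bilinear_l _ (@tensor_bilinear _ _ _)); multilinear
      | apply: (bilinear_r _ (@tensor_bilinear _ _ _)); multilinear
      | apply: (linear_after (@antipode_linear _ _ _)); multilinear
      | match goal with h : GRing.linear_for _ _ |- _ =>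
          apply: (linear_after h); multilinear end
      | match goal with h : is_bilinear _ |- _ =>
          apply: (bilinear_l _ h); multilinear end
      | match goal with h : is_bilinear _ |- _ =>
          apply: (bilinear_r _ h); multilinear end
      ]
  end.

(** * Sweedler calculus *)

Section Sweedler.
Variables (k : fieldType) (C : coalgebra k).
Implicit Types (U : lmodType k) (a : C).

(** Coassociativity in the form used in computations: the image of comulA under
    the linear map on C ⊗ (C ⊗ C) induced by the trilinear F. *)
Lemma sw_coassoc U (F : C -> C -> C -> U) a :
  (forall y z, linear (fun x => F x y z)) ->
  (forall x z, linear (fun y => F x y z)) ->
  (forall x y, linear (fun z => F x y z)) ->
  \sw_(t, z <- a) \sw_(x, y <- t) F x y z = \sw_(x, y, z <- a) F x y z.
Proof.
move=> F1 F2 F3; pose g := bigtens (fun x => bigtens (F x)).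
have Fb x : is_bilinear (F x) by [].
have hb : is_bilinear (fun x => bigtens (F x)).
  by split=> [t|x]; [multilinear | exact: bigtens_linear].
have gl : linear g by exact: bigtens_linear hb.
have := congr1 g (comulA a); rewrite !(linear_bigtens _ _ gl) => e.
symmetry; etransitivity; last (etransitivity; first exact: e); apply: eq_bigtens => x y;
  rewrite (linear_bigtens _ _ gl); apply: eq_bigtens => z t;
  by rewrite /g (bigtensE _ _ hb) bigtensE.
Qed.

Lemma sw_counitl U (f : C -> U) a :
  linear f -> \sw_(x, y <- a) (counit x *: f y) = f a.
Proof.
move=> fl; rewrite -[in RHS](comul_counitl a) (linear_bigtens _ _ fl).
by apply: eq_bigtens => x y; rewrite (linear_eqZ _ _ fl).
Qed.

Lemma sw_hom (D : coalgebra k) (p : C -> D) U (F : D -> D -> U) a :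
  coalg_hom p -> is_bilinear F ->
  \sw_(x, y <- p a) F x y = \sw_(x, y <- a) F (p x) (p y).
Proof.
move=> ph Fb; rewrite (coalg_hom_comul ph) (linear_bigtens _ _ (bigtens_linear Fb)).
by apply: eq_bigtens => x y; rewrite bigtensE.
Qed.

Variable H : hopf_structure C.

Lemma sw_mul U (F : C -> C -> U) a b : is_bilinear F ->
  \sw_(x, y <- hmul H a b) F x y =
  \sw_(a1, a2 <- a) \sw_(b1, b2 <- b) F (hmul H a1 b1) (hmul H a2 b2).
Proof.
move=> Fb; have Fl := bigtens_linear Fb.
rewrite comul_mul (linear_bigtens _ _ Fl); apply: eq_bigtens => a1 a2.
by rewrite (linear_bigtens _ _ Fl); apply: eq_bigtens => b1 b2; rewrite bigtensE.
Qed.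

Lemma sw_one U (F : C -> C -> U) : is_bilinear F ->
  \sw_(x, y <- hone H) F x y = F (hone H) (hone H).
Proof. by move=> Fb; rewrite comul_one bigtensE. Qed.

Lemma hmulZl c a b : hmul H (c *: a) b = c *: hmul H a b.
Proof. exact: (linear_eqZ _ _ ((hmul_bilinear H).1 b)). Qed.

(** The antipode is the convolution inverse of the identity, so convolving on
    the left with one and then the other cancels. *)
Lemma antipodeKl a (f : C -> C) : linear f ->
  \sw_(x, y, z <- a) hmul H (antipode H x) (hmul H y (f z)) = f a.
Proof.
move=> fl; rewrite -sw_coassoc; try multilinear.
rewrite -[RHS]sw_counitl //; apply: eq_bigtens => t z.
transitivity (hmul H (\sw_(x, y <- t) hmul H (antipode H x) y) (f z)).
  rewrite (linear_bigtens _ _ ((hmul_bilinear H).1 (f z))).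
  by apply: eq_bigtens => x y; rewrite hmulA.
by rewrite antipodel hmulZl hmul1l.
Qed.

Lemma antipodeKr a (f : C -> C) : linear f ->
  \sw_(x, y, z <- a) hmul H x (hmul H (antipode H y) (f z)) = f a.
Proof.
move=> fl; rewrite -sw_coassoc; try multilinear.
rewrite -[RHS]sw_counitl //; apply: eq_bigtens => t z.
transitivity (hmul H (\sw_(x, y <- t) hmul H x (antipode H y)) (f z)).
  rewrite (linear_bigtens _ _ ((hmul_bilinear H).1 (f z))).
  by apply: eq_bigtens => x y; rewrite hmulA.
by rewrite antipoder hmulZl hmul1l.
Qed.

Lemma antipode_one : antipode H (hone H) = hone H.
Proof.
have := antipoder H (hone H); rewrite sw_one; last multilinear.
by rewrite hmul1l counit_one scale1r.
Qed.

End Sweedler.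

(** * The action attached to a Hopf brace *)

Section BraceAction.
Variables (k : fieldType) (C : coalgebra k) (D O : hopf_structure C).
Local Notation "x • y" := (hmul D x y) (at level 40, left associativity).
Local Notation "x ∘ y" := (hmul O x y) (at level 40, left associativity).
Local Notation S := (antipode D).
Implicit Types a b c : C.

Definition brace_action a b : C := \sw_(x, y <- a) (S x • (y ∘ b)).
Local Notation "a ⇀ b" := (brace_action a b) (at level 40, left associativity).

Lemma brace_action_bilinear : is_bilinear brace_action.
Proof. by rewrite /brace_action; multilinear. Qed.

Lemma circ_brace_action a b : a ∘ b = \sw_(x, y <- a) (x • (y ⇀ b)).
Proof.
rewrite -(antipodeKr D (f := fun x => x ∘ b) a); last multilinear.
apply: eq_bigtens => x t; rewrite (linear_bigtens _ _ ((hmul_bilinear D).2 x)).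
by [].
Qed.

(** Recovers an action from the product that it defines: convolving
    a ∘ b = a_1 M(a_2, b) with the antipode leaves M. *)
Lemma cocycle_antipode (M : C -> C -> C) a b : is_bilinear M ->
  (forall a, a ∘ b = \sw_(x, y <- a) (x • M y b)) ->
  \sw_(x, y <- a) (S x • (y ∘ b)) = M a b.
Proof.
move=> Mb e; rewrite -(antipodeKl D (f := fun x => M x b) a); last multilinear.
apply: eq_bigtens => x t.
by rewrite e (linear_bigtens _ _ ((hmul_bilinear D).2 _)).
Qed.

Hypothesis compat : forall a b c,
  a ∘ (b • c) = \sw_(x, y, z <- a) ((x ∘ b) • S y • (z ∘ c)).

(** At a = 1_∘, b = c = 1 the compatibility reads 1 = S(1_∘), since 1_∘ is
    grouplike; and S(1_∘) is inverse to 1_∘. *)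
Lemma brace_one : hone O = hone D.
Proof.
have := compat (hone O) (hone D) (hone D).
rewrite hmul1l hmul1l sw_one; last multilinear.
rewrite sw_one; last multilinear.
rewrite !hmul1l hmul1r => e.
have := antipodel D (hone O); rewrite sw_one; last multilinear.
by rewrite -e hmul1l counit_one scale1r.
Qed.

Lemma circ_mul a b c : a ∘ (b • c) = \sw_(x, y <- a) ((x ∘ b) • (y ⇀ c)).
Proof.
rewrite compat; apply: eq_bigtens => x t.
rewrite (linear_bigtens _ _ ((hmul_bilinear D).2 _)).
by apply: eq_bigtens => y z; rewrite hmulA.
Qed.

Lemma brace_action_prod a b c :
  a ⇀ (b • c) = \sw_(x, y <- a) ((x ⇀ b) • (y ⇀ c)).
Proof.
have actb := brace_action_bilinear.
transitivity (\sw_(x, y, z <- a) (S x • (y ∘ b) • (z ⇀ c))).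
  apply: eq_bigtens => x t.
  rewrite circ_mul (linear_bigtens _ _ ((hmul_bilinear D).2 _)).
  by apply: eq_bigtens => y z; rewrite hmulA.
rewrite -sw_coassoc; try multilinear.
apply: eq_bigtens => x t.
by rewrite -(linear_bigtens _ _ ((hmul_bilinear D).1 _)).
Qed.

Lemma brace_action1 a : hone O ⇀ a = a.
Proof.
rewrite /brace_action sw_one; last multilinear.
by rewrite brace_one antipode_one hmul1l -brace_one hmul1l.
Qed.

Lemma brace_action_unit a : a ⇀ hone D = counit a *: hone D.
Proof.
rewrite -antipodel; apply: eq_bigtens => x y.
by rewrite -brace_one hmul1r.
Qed.

(** Associativity of ∘ gives the identity of prod_circ in the proof, and
    multiplying it by S(a_1 ∘ b_1) cancels a_2 ∘ b_2. *)
Lemma brace_action_comp a b c : (a ∘ b) ⇀ c = a ⇀ (b ⇀ c).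
Proof.
have actb := brace_action_bilinear.
rewrite {1}/brace_action sw_mul; last multilinear.
pose X x y := x ⇀ (y ⇀ c).
have Xb : is_bilinear X by rewrite /X; multilinear.
have prod_circ x y : (x ∘ y) ∘ c =
    \sw_(x1, x2 <- x) \sw_(y1, y2 <- y) ((x1 ∘ y1) • X x2 y2).
  rewrite -hmulA [y ∘ c]circ_brace_action (linear_bigtens _ _ ((hmul_bilinear O).2 _)).
  rewrite [RHS]bigtens_exchange.
  by apply: eq_bigtens => y1 y2; rewrite circ_mul.
(* Sum over a_1, a_2, a_3 and b_1, b_2, b_3, to be regrouped as (a_1, a_2), a_3
   and (b_1, b_2), b_3 so that the inner sum runs over the
   coproduct of a single product t ∘ u, where the antipode cancels. *)
pose F x y x1 y1 x2 y2 := S (x ∘ y) • ((x1 ∘ y1) • X x2 y2).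
transitivity (\sw_(x, x1, x2 <- a) \sw_(y, y1, y2 <- b) F x y x1 y1 x2 y2).
  apply: eq_bigtens => x t; rewrite bigtens_exchange.
  apply: eq_bigtens => y u.
  rewrite prod_circ (linear_bigtens _ _ ((hmul_bilinear D).2 _)).
  by apply: eq_bigtens => x1 x2; rewrite (linear_bigtens _ _ ((hmul_bilinear D).2 _)).
rewrite -sw_coassoc; rewrite /F; try multilinear.
transitivity (\sw_(t, x2 <- a) \sw_(u, y2 <- b) (counit t *: (counit u *: X x2 y2))).
  apply: eq_bigtens => t x2.
  transitivity (\sw_(x, x1 <- t) \sw_(u, y2 <- b) \sw_(y, y1 <- u) F x y x1 y1 x2 y2).
    by apply: eq_bigtens => x x1; rewrite -sw_coassoc /F //; multilinear.
  rewrite bigtens_exchange; apply: eq_bigtens => u y2.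
  rewrite -(sw_mul O (F := fun p q => S p • (q • X x2 y2))); last multilinear.
  transitivity ((\sw_(p, q <- t ∘ u) (S p • q)) • X x2 y2).
    rewrite (linear_bigtens _ _ ((hmul_bilinear D).1 _)).
    by apply: eq_bigtens => p q; rewrite hmulA.
  by rewrite antipodel hmulZl hmul1l counit_mul scalerA.
rewrite -[RHS](sw_counitl (f := fun x => X x b) a); last multilinear.
apply: eq_bigtens => t x2.
rewrite -(linear_bigtens _ _ (linear_scalel _ (@linear_idfun _ _))).
by rewrite sw_counitl //; multilinear.
Qed.

End BraceAction.

Lemma brace_module_algebra (k : fieldType) (B : hopf_brace k) :
  @module_algebra k (HopfAlgebra (brace_circ B)) B
    (brace_action (hopf_str B) (brace_circ B)).
Proof.
have compat := @brace_compat k B.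
split; [exact: brace_action_bilinear | exact: brace_action_comp
 | exact: brace_action1 | exact: brace_action_prod | exact: brace_action_unit].
Qed.

Lemma coalg_iso_id (k : fieldType) (C : coalgebra k) : @coalg_iso k C C id.
Proof. by split; [exact: coalg_hom_id | exists id; split=> //; exact: coalg_hom_id]. Qed.

Definition brace_cocycle (k : fieldType) (B : hopf_brace k) : bij_cocycle k :=
  @BijCocycle k (HopfAlgebra (brace_circ B)) B _ (brace_module_algebra B) id
    (coalg_iso_id B) (@circ_brace_action k B (hopf_str B) (brace_circ B)).

(** * Transport of a Hopf structure along a coalgebra isomorphism *)

Section Transport.
Variables (k : fieldType) (C E : coalgebra k) (H : hopf_structure C).
Variables (p : C -> E) (r : E -> C).
Hypotheses (ph : coalg_hom p) (rh : coalg_hom r) (pK : cancel p r) (rK : cancel r p).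

Let pl := coalg_hom_linear ph.
Let rl := coalg_hom_linear rh.

Lemma transport_bilinear : is_bilinear (fun a b => p (hmul H (r a) (r b))).
Proof. by multilinear. Qed.

Lemma transport_comul_mul a b :
  comul (p (hmul H (r a) (r b))) =
  \sw_(a1, a2 <- a) \sw_(b1, b2 <- b)
     (p (hmul H (r a1) (r b1)) ⊗ p (hmul H (r a2) (r b2))).
Proof.
rewrite (coalg_hom_comul ph) sw_mul; last multilinear.
rewrite (sw_hom _ rh); last multilinear.
by apply: eq_bigtens => a1 a2; rewrite (sw_hom _ rh); last multilinear.
Qed.

Lemma transport_antipodel a :
  \sw_(x, y <- a) p (hmul H (r (p (antipode H (r x)))) (r y)) =
  counit a *: p (hone H).
Proof.
rewrite -(linear_eqZ _ _ pl) -(coalg_hom_counit rh) -antipodel.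
rewrite (linear_bigtens _ _ pl) (sw_hom _ rh); last multilinear.
by apply: eq_bigtens => x y; rewrite pK.
Qed.

Lemma transport_antipoder a :
  \sw_(x, y <- a) p (hmul H (r x) (r (p (antipode H (r y))))) =
  counit a *: p (hone H).
Proof.
rewrite -(linear_eqZ _ _ pl) -(coalg_hom_counit rh) -antipoder.
rewrite (linear_bigtens _ _ pl) (sw_hom _ rh); last multilinear.
by apply: eq_bigtens => x y; rewrite pK.
Qed.

Definition transport : hopf_structure E.
Proof.
apply: (@HopfStructure k E (fun a b => p (hmul H (r a) (r b))) (p (hone H))
  (fun a => p (antipode H (r a)))).
- exact: transport_bilinear.
- by move=> a b c; rewrite !pK hmulA.
- by move=> a; rewrite pK hmul1l rK.
- by move=> a; rewrite pK hmul1r rK.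
- exact: transport_comul_mul.
- by rewrite (coalg_hom_comul ph) sw_one //; multilinear.
- by move=> a b; rewrite (coalg_hom_counit ph) counit_mul !(coalg_hom_counit rh).
- by rewrite (coalg_hom_counit ph) counit_one.
- by apply: (linear_after pl); apply: (linear_after (@antipode_linear _ _ _)).
- exact: transport_antipodel.
- exact: transport_antipoder.
Defined.

Lemma transport_fwd : hopf_hom_of H transport p.
Proof. by split=> // a *; rewrite /= ?pK. Qed.

Lemma transport_bwd : hopf_hom_of transport H r.
Proof. by split=> //= *; rewrite pK. Qed.

End Transport.

(** * The Hopf brace of a bijective 1-cocycle *)

Section CocycleBrace.
Variables (k : fieldType) (p : bij_cocycle k).
Local Notation H := (coc_source p).
Local Notation A := (coc_target p).

Definition coc_inv : A -> H := sval (cid (coc_iso p).2).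

Lemma coc_inv_hom : coalg_hom coc_inv.
Proof. by rewrite /coc_inv; case: cid => ? []. Qed.

Lemma coc_mapK : cancel (@coc_map _ p) coc_inv.
Proof. by rewrite /coc_inv; case: cid => ? []. Qed.

Lemma coc_invK : cancel coc_inv (@coc_map _ p).
Proof. by rewrite /coc_inv; case: cid => ? []. Qed.

Definition coc_circ : hopf_structure A :=
  transport (hopf_str H) (coc_iso p).1 coc_inv_hom coc_mapK coc_invK.

Local Notation "a ∘ b" := (hmul coc_circ a b) (at level 40, left associativity).

Lemma coc_act_inv_bilinear : is_bilinear (fun a b => coc_act (coc_inv a) b).
Proof.
have rl := coalg_hom_linear coc_inv_hom.
have ab := act_bilinear (coc_module p).
by multilinear.
Qed.

Lemma coc_circE a b :
  a ∘ b = \sw_(x, y <- a) (x · coc_act (coc_inv y) b).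
Proof.
have rl := coalg_hom_linear coc_inv_hom.
have pl := coalg_hom_linear (coc_iso p).1.
have ab := act_bilinear (coc_module p).
rewrite [LHS]/= [LHS]coc_cocycle coc_invK (sw_hom _ coc_inv_hom); last first.
  by rewrite /mulH; multilinear.
by apply: eq_bigtens => x y; rewrite coc_invK.
Qed.

Lemma coc_action_circ a b :
  brace_action (hopf_str A) coc_circ a b = coc_act (coc_inv a) b.
Proof.
exact: (cocycle_antipode a coc_act_inv_bilinear (fun x => coc_circE x b)).
Qed.

(** Both sides equal a_1 (π⁻¹(a_2) ⇀ b)(π⁻¹(a_3) ⇀ c): the left by the
    module-algebra property, the right because S(a_2)(a_3 ∘ c) is
    π⁻¹(a_2) ⇀ c. *)
Lemma coc_brace_compat a b c :
  a ∘ (b · c) = \sw_(x, y, z <- a) ((x ∘ b) · antiH y · (z ∘ c)).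
Proof.
have Mb := coc_act_inv_bilinear.
have rl := coalg_hom_linear coc_inv_hom.
have ab := act_bilinear (coc_module p).
transitivity (\sw_(x, y <- a) ((x ∘ b) · coc_act (coc_inv y) c)); last first.
  apply: eq_bigtens => x t; rewrite -coc_action_circ.
  rewrite /mulH (linear_bigtens _ _ ((hmul_bilinear _).2 _)).
  by apply: eq_bigtens => y z; rewrite hmulA.
transitivity (\sw_(x, y, z <- a)
    (x · coc_act (coc_inv y) b · coc_act (coc_inv z) c)).
  rewrite coc_circE; apply: eq_bigtens => x t.
  rewrite (act_prod (coc_module p)) (sw_hom _ coc_inv_hom); last first.
    by rewrite /mulH; multilinear.
  rewrite /mulH (linear_bigtens _ _ ((hmul_bilinear _).2 _)).
  by apply: eq_bigtens => y z; rewrite hmulA.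
rewrite -sw_coassoc; rewrite /mulH; try multilinear.
apply: eq_bigtens => t z; rewrite coc_circE.
by rewrite (linear_bigtens _ _ ((hmul_bilinear _).1 _)).
Qed.

Definition cocycle_brace : hopf_brace k := HopfBrace coc_brace_compat.

End CocycleBrace.

(** * The equivalence *)

Lemma brace_hom_cocycle (k : fieldType) (A B : hopf_brace k) (f : A -> B) :
  brace_hom f -> @cocycle_hom k (brace_cocycle A) (brace_cocycle B) (f, f).
Proof.
move=> [fd fo]; split=> //= a b.
have fl := coalg_hom_linear (hopf_hom_coalg fd).
rewrite /brace_action (linear_bigtens _ _ fl) (sw_hom _ (hopf_hom_coalg fd)); last first.
  by multilinear.
apply: eq_bigtens => x y.
by rewrite (hopf_hom_mul fd) (hopf_hom_antipode fd) (hopf_hom_mul fo).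
Qed.

(** For a morphism (f, g) from π to η this is η⁻¹ g = f π⁻¹. It makes g preserve
    the transported products, and it is the naturality square of the
    isomorphism (π⁻¹, id). *)
Lemma cocycle_hom_inv (k : fieldType) (p q : bij_cocycle k) fg :
  @cocycle_hom k p q fg -> forall a, coc_inv (fg.2 a) = fg.1 (coc_inv a).
Proof.
move=> h a; apply: (can_inj (@coc_mapK k q)).
by rewrite coc_invK (cocycle_hom_map h) coc_invK.
Qed.

Lemma cocycle_hom_brace (k : fieldType) (p q : bij_cocycle k) fg :
  @cocycle_hom k p q fg -> @brace_hom k (cocycle_brace p) (cocycle_brace q) fg.2.
Proof.
move=> h; have [fs ft fm fa] := h; split=> //.
split=> [|a b||a]; first exact: hopf_hom_coalg ft.
- by rewrite /= !(cocycle_hom_inv h) -fm (hopf_hom_mul fs).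
- by rewrite /= -fm (hopf_hom_one fs).
- by rewrite /= (cocycle_hom_inv h) -fm (hopf_hom_antipode fs).
Qed.

Section Equivalence.
Variables (k : fieldType) (A : hopf_algebra k).

Definition to_cocycle : functor (Br A) (Coc A).
Proof.
apply: (@Functor (Br A) (Coc A)
  (fun B => exist _ (brace_cocycle (sval B)) (svalP B))
  (fun B B' f => exist _ _ (brace_hom_cocycle (svalP f)))).
- by move=> B; apply: sig_hom_eq.
- by move=> B B' B'' f g; apply: sig_hom_eq.
Defined.

Definition to_brace : functor (Coc A) (Br A).
Proof.
apply: (@Functor (Coc A) (Br A)
  (fun p => exist _ (cocycle_brace (sval p)) (svalP p))
  (fun p q f => exist _ _ (cocycle_hom_brace (svalP f)))).
- by move=> p; apply: sig_hom_eq.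
- by move=> p q r f g; apply: sig_hom_eq.
Defined.

(** The inverse of a cocycle is obtained by choice, so even for the identity it
    is only provably, not definitionally, the identity. *)
Lemma coc_map_id_inv (B : hopf_brace k) a : coc_inv (p := brace_cocycle B) a = a.
Proof. exact: (@coc_invK k (brace_cocycle B) a). Qed.

Lemma brace_unit_hom (B : hopf_brace k) :
  @brace_hom k (cocycle_brace (brace_cocycle B)) B id.
Proof.
split; first exact: hopf_hom_of_id.
split=> [|a b||a] //=; first exact: coalg_hom_id.
- by rewrite !coc_map_id_inv.
- by rewrite !coc_map_id_inv.
Qed.

Lemma brace_unit_inv_hom (B : hopf_brace k) :
  @brace_hom k B (cocycle_brace (brace_cocycle B)) id.
Proof. by split; [exact: hopf_hom_of_id | exact: transport_fwd]. Qed.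

Lemma cocycle_counit_hom (p : bij_cocycle k) :
  @cocycle_hom k (brace_cocycle (cocycle_brace p)) p (@coc_inv k p, id).
Proof.
split=> [||a|a b] /=; [exact: transport_bwd | exact: hopf_hom_of_id
  | exact: coc_invK | exact: coc_action_circ].
Qed.

Lemma cocycle_counit_inv_hom (p : bij_cocycle k) :
  @cocycle_hom k p (brace_cocycle (cocycle_brace p)) (@coc_map k p, id).
Proof.
split=> [||//|a b] /=; [exact: transport_fwd | exact: hopf_hom_of_id |].
by rewrite coc_action_circ coc_mapK.
Qed.

Lemma brace_nat_iso : nat_iso (comp_functor to_brace to_cocycle) (id_functor (Br A)).
Proof.
apply: (@NatIso _ _ (comp_functor to_brace to_cocycle) (id_functor (Br A))
  (fun B => exist _ _ (brace_unit_hom (sval B)))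
  (fun B => exist _ _ (brace_unit_inv_hom (sval B)))).
- by move=> B; apply: sig_hom_eq.
- by move=> B; apply: sig_hom_eq.
- by move=> B B' f; apply: sig_hom_eq.
Qed.

Lemma cocycle_nat_iso : nat_iso (comp_functor to_cocycle to_brace) (id_functor (Coc A)).
Proof.
apply: (@NatIso _ _ (comp_functor to_cocycle to_brace) (id_functor (Coc A))
  (fun p => exist _ _ (cocycle_counit_hom (sval p)))
  (fun p => exist _ _ (cocycle_counit_inv_hom (sval p)))).
- by move=> p; apply: sig_hom_eq; congr pair; apply: funext => a; exact: coc_invK.
- by move=> p; apply: sig_hom_eq; congr pair; apply: funext => a; exact: coc_mapK.
- move=> p q f; apply: sig_hom_eq; congr pair; apply: funext => a.
  exact: cocycle_hom_inv (svalP f) a.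
Qed.

End Equivalence.

Theorem theorem1p12 (k : fieldType) (A : hopf_algebra k) :
  equivalent_categories (Br A) (Coc A).
Proof.
exists (to_cocycle A), (to_brace A).
by split; constructor; [exact: brace_nat_iso | exact: cocycle_nat_iso].
Qed.
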